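(* Let $(f_1,\dots,f_n)$ be an $n$-player continuous game on $X=X_1\times\cdots\times X_n$, $X_i=\mathbb{R}^{d_i}$, such that each $f_i\in C^q(X,\mathbb{R})$ for some $q\ge 2$ and $\omega(x)=(D_1f_1(x),\dots,D_nf_n(x))$ is $L$-Lipschitz. Let $x^\ast\in X$ be a stable differential Nash equilibrium. Let $B_r(x^\ast)$ be the largest ball centered at $x^\ast$, contained in the region of attraction $\mathcal{V}(x^\ast)$ of $x^\ast$, on which the symmetric part $S(x)=\frac12(J(x)+J(x)^T)$ of the game Jacobian is positive definite, and let $$\alpha=\min_{x\in B_r(x^\ast)}\lambda_d\big(S(x)^TS(x)\big),\qquad \beta=\max_{x\in B_r(x^\ast)}\lambda_1\big(J(x)^TJ(x)\big).$$ Suppose $x_0\in B_r(x^\ast)$ and $\alpha<\beta$. Then, given $\varepsilon>0$, the gradient-based learning dynamics $x_{k+1}=x_k-\gamma\,\omega(x_k)$ with learning rate $\gamma=\sqrt{\alpha}/\beta$ obtain an $\varepsilon$-differential Nash equilibrium, in the sense that $x_k\in B_\varepsilon(x^\ast)\subset B_r(x^\ast)$ for all $$k\ge\left\lceil 2\,\frac{\beta}{\alpha}\,\log\frac{r}{\varepsilon}\right\rceil.$$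
   Context: Player $i\in\{1,\dots,n\}$ has action $x_i\in X_i=\mathbb{R}^{d_i}$ and cost $f_i:X\to\mathbb{R}$; $d=\sum_i d_i$. $D_if_i$ is the derivative of $f_i$ with respect to $x_i$ and $D_i^2f_i$ the second derivative with respect to $x_i$. The game Jacobian $J(x)$ is the Jacobian of $\omega$ at $x$ (generally not symmetric). For a symmetric $d\times d$ matrix $A$, $\lambda_d(A)\le\cdots\le\lambda_1(A)$ are its eigenvalues. A point $x^\ast$ is a differential Nash equilibrium if $\omega(x^\ast)=0$ and $D_i^2f_i(x^\ast)$ is positive definite for every $i$; it is stable if every eigenvalue of $J(x^\ast)$ has strictly positive real part. The region of attraction $\mathcal{V}(x^\ast)$ is that of $x^\ast$ as an equilibrium of $\dot x=-\omega(x)$. $B_\rho(x^\ast)$ is the Euclidean ball of radius $\rho$ around $x^\ast$.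
   Formalization: The ball B_r need not be the largest one (a largest ball with positive attained α cannot exist); the result holds for every such ball, open or closed, with attained α and β, and the inclusion of B_ε in B_r is claimed only for ε ≤ r, since it fails for ε > r. *)

(* Defs.v *)
From HB Require Import structures.
From mathcomp Require Import all_boot all_order all_algebra.
From mathcomp Require Import all_classical all_reals all_analysis.
From mathcomp Require Import complex.

Set Implicit Arguments.
Unset Strict Implicit.
Unset Printing Implicit Defensive.

Import Order.TTheory GRing.Theory Num.Theory.
Import numFieldNormedType.Exports.

Local Open Scope classical_set_scope.
Local Open Scope ring_scope.

(* The norm that the library puts on 'rV[R]_n is the sup norm; it is only used
   for the topology and for derivatives. Distances use the Euclidean norm. *)
Definition l2norm (R : realType) (n : nat) (x : 'rV[R]_n) : R :=
  Num.sqrt (\sum_(j < n) x 0 j ^+ 2).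

(* Euclidean ball of radius rho around a, closed if c is true and open if c is
   false. *)
Definition eball (R : realType) (n : nat) (c : bool) (a : 'rV[R]_n) (rho : R) :
    set 'rV[R]_n :=
  [set x | l2norm (x - a) < rho ?<= if c].

Definition l2_lipschitz (R : realType) (n m : nat) (L : R)
    (g : 'rV[R]_n -> 'rV[R]_m) : Prop :=
  forall x y, l2norm (g x - g y) <= L * l2norm (x - y).

Fixpoint is_C (R : realType) (n q : nat) (f : 'rV[R]_n -> R) : Prop :=
  match q with
  | 0 => continuous f
  | q'.+1 => (forall x, differentiable f x) /\ forall v, is_C q' ('D_v f)
  end.

Definition posdefmx (R : realType) (n : nat) (A : 'M[R]_n) : Prop :=
  forall v : 'rV[R]_n, v != 0 -> 0 < (v *m A *m v^T) 0 0.

(* Eigenvalues with multiplicity, in nonincreasing order. The sequence exists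
   for every symmetric A (it is empty by default if the characteristic
   polynomial does not split over R) and is unique. *)
Definition eigenvalues (R : realType) (n : nat) (A : 'M[R]_n) : seq R :=
  xget [::] [set s | sorted >=%R s /\
                     char_poly A = \prod_(z <- s) ('X - z%:P)].

(* k is counted from 1: lambda 1 A is the largest eigenvalue of a symmetric A
   and lambda n A the smallest one. *)
Definition lambda (R : realType) (n : nat) (k : nat) (A : 'M[R]_n) : R :=
  nth 0 (eigenvalues A) k.-1.

Definition is_minimum (R : realType) (E : set R) (m : R) : Prop :=
  E m /\ lbound E m.

Definition is_maximum (R : realType) (E : set R) (m : R) : Prop :=
  E m /\ ubound E m.

(* Initial points of solutions on [0, +oo[ of phi' = g(phi) that converge
   to a. *)
Definition region_of_attraction (R : realType) (n : nat)
    (g : 'rV[R]_n -> 'rV[R]_n) (a : 'rV[R]_n) : set 'rV[R]_n :=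
  [set y | exists phi : R -> 'rV[R]_n,
    [/\ phi 0 = y,
        {within `[0, +oo[, continuous phi},
        (forall t : R, 0 < t -> is_derive t 1 phi (g (phi t))) &
        phi t @[t --> +oo] --> a]].

(* A joint action is a row vector of length \sum_i d i; its i-th block of
   length d i is the action of player i. Coordinate j of player i has position
   tagnat.Rank i j in the joint action. *)
Definition e_ (R : realType) (n : nat) (d : 'I_n -> nat) (i : 'I_n)
    (j : 'I_(d i)) : 'rV[R]_(\sum_(i < n) d i) :=
  delta_mx 0 (tagnat.Rank i j).

Section Game.
Variables (R : realType) (n : nat) (d : 'I_n -> nat).
Local Notation X := 'rV[R]_(\sum_(i < n) d i).

Definition D1_ (i : 'I_n) (h : X -> R) (x : X) : 'rV[R]_(d i) :=
  \row_j 'D_(e_ R j) h x.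

Definition D2_ (i : 'I_n) (h : X -> R) (x : X) : 'M[R]_(d i) :=
  \matrix_(j, k) 'D_(e_ R k) ('D_(e_ R j) h) x.

Variable f : 'I_n -> X -> R.

Definition omega (x : X) : X := \mxrow_(i < n) D1_ i (f i) x.

(* The library's jacobian acts on row vectors from the right, so it is the
   transpose of the usual matrix of partial derivatives. *)
Definition game_jacobian (x : X) : 'M[R]_(\sum_(i < n) d i) :=
  (jacobian omega x)^T.

Definition sym_jacobian (x : X) : 'M[R]_(\sum_(i < n) d i) :=
  2^-1 *: (game_jacobian x + (game_jacobian x)^T).

Definition differential_Nash (x : X) : Prop :=
  omega x = 0 /\ forall i : 'I_n, posdefmx (D2_ i (f i) x).

Definition stable (x : X) : Prop :=
  forall z : R[i],
    eigenvalue (map_mx (real_complex R) (game_jacobian x)) z ->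
    0 < complex.Re z.

(* No maximality of r is required. A ball with these properties that is maximal
   has a boundary point at which the symmetric part is singular: if it were
   positive definite on the closed ball, it would be so on a larger ball, and
   the squared distance to a would be a strict Lyapunov function there. The
   smallest eigenvalue of S^T S would then have infimum 0 on the ball. *)
Definition attraction_ball (c : bool) (a : X) (r : R) : Prop :=
  [/\ 0 < r,
      eball c a r `<=` region_of_attraction (fun x => - omega x) a &
      forall x, eball c a r x -> posdefmx (sym_jacobian x)].

Definition gradient_play (gamma : R) (x0 : X) (k : nat) : X :=
  iter k (fun x => x - gamma *: omega x) x0.

End Game.

(* Main.v *)
Require Import Defs.
From HB Require Import structures.
From mathcomp Require Import all_boot all_order all_algebra.
From mathcomp Require Import all_classical all_reals all_analysis.
From mathcomp Require Import complex spectral sesquilinear ring lra.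

Set Implicit Arguments.
Unset Strict Implicit.
Unset Printing Implicit Defensive.

Import Order.TTheory GRing.Theory Num.Theory.
Import numFieldNormedType.Exports.

Local Open Scope classical_set_scope.
Local Open Scope ring_scope.

(** The map [T x = x - gamma *: omega f x] contracts Euclidean distances to
    [xs] on the ball. Linearly, for a Jacobian [J] with symmetric part [S],
    [|v - gamma J v|^2 = |v|^2 - 2 gamma <v, J v> + gamma^2 |J v|^2].
    The antisymmetric part of [J] drops out of [<v, J v>], which equals
    [<v, S v>]. As [S] is positive definite and the eigenvalues of [S^T S] are
    at least [alpha], those of [S] are at least [sqrt alpha]; and [|J v|^2] is
    at most [beta |v|^2]. With [gamma = sqrt alpha / beta] the right-hand side
    is then at most [(1 - alpha / beta) |v|^2] ([contraction_step]).

    A mean value inequality ([mean_value_l2norm]) carries this bound from the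
    derivative to [T]: along the segment from the fixed point [xs] to [x],
    which lies in the ball, [|T x - T xs|] is at most the norm of the
    derivative of [T] in the direction [x - xs] at some point of the segment.
    Hence [T] maps the ball to itself, and after [k] steps the distance to [xs]
    has shrunk by [sqrt (1 - alpha / beta) ^+ k], which is at most
    [expR (- k alpha / (2 beta))]; this is at most [eps / r] as soon as [k]
    reaches [2 (beta / alpha) ln (r / eps)] ([geometric_rate]).

    The numbers [lambda k A] are read off a factorization of the characteristic
    polynomial. That such a factorization exists over the reals, and that its
    extreme roots bound the quadratic form of [A], is obtained by unitary
    diagonalization of [A] over the complex numbers
    ([symmetric_spectral], [Rayleigh_bounds]). *)

(** * Euclidean inner product and balls *)

Lemma le_lteif_trans disp (T : porderType disp) (x y z : T) c :
  (x <= y)%O -> (y < z ?<= if c)%O -> (x < z ?<= if c)%O.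
Proof. exact: (@lteif_trans _ _ x y z true c). Qed.

Lemma lteif_le_trans disp (T : porderType disp) (x y z : T) c :
  (x < y ?<= if c)%O -> (y <= z)%O -> (x < z ?<= if c)%O.
Proof. by rewrite -{2}(andbT c); exact: (@lteif_trans _ _ x y z c true). Qed.

Definition dot (R : realType) (n : nat) (u v : 'rV[R]_n) : R := (u *m v^T) 0 0.

Lemma dotE (R : realType) n (u v : 'rV[R]_n) : dot u v = \sum_j u 0 j * v 0 j.
Proof. by rewrite /dot mxE; apply: eq_bigr => j _; rewrite mxE. Qed.

Lemma dotC (R : realType) n (u v : 'rV[R]_n) : dot u v = dot v u.
Proof. by rewrite !dotE; apply: eq_bigr => j _; rewrite mulrC. Qed.

Lemma dotBl (R : realType) n (u v w : 'rV[R]_n) :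
  dot (u - v) w = dot u w - dot v w.
Proof. by rewrite /dot mulmxBl !mxE. Qed.

Lemma dotZl (R : realType) n a (u v : 'rV[R]_n) : dot (a *: u) v = a * dot u v.
Proof. by rewrite /dot -scalemxAl mxE. Qed.

Lemma dot_sqrB (R : realType) n (u v : 'rV[R]_n) :
  dot (u - v) (u - v) = dot u u - 2 * dot u v + dot v v.
Proof. by rewrite dotBl ![dot _ (u - v)]dotC !dotBl (dotC v u); ring. Qed.

Lemma dot_ge0 (R : realType) n (v : 'rV[R]_n) : 0 <= dot v v.
Proof. by rewrite dotE sumr_ge0 // => j _; rewrite -expr2 sqr_ge0. Qed.

Lemma dot_gt0 (R : realType) n (v : 'rV[R]_n) : v != 0 -> 0 < dot v v.
Proof.
move=> v0; rewrite lt_def dot_ge0 andbT; apply: contra v0 => /eqP.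
rewrite dotE => /psumr_eq0P v0; apply/eqP/rowP => j; rewrite mxE.
by apply/eqP; rewrite -sqrf_eq0 expr2 v0 // => i _; rewrite -expr2 sqr_ge0.
Qed.

Lemma l2normE (R : realType) n (v : 'rV[R]_n) : l2norm v = Num.sqrt (dot v v).
Proof. by rewrite /l2norm dotE. Qed.

Lemma l2norm_ge0 (R : realType) n (v : 'rV[R]_n) : 0 <= l2norm v.
Proof. exact: sqrtr_ge0. Qed.

Lemma l2normZ (R : realType) n a (v : 'rV[R]_n) :
  l2norm (a *: v) = `|a| * l2norm v.
Proof.
by rewrite !l2normE dotZl dotC dotZl mulrA -expr2 sqrtrM ?sqr_ge0 // sqrtr_sqr.
Qed.

Lemma eball_segment (R : realType) n c (a v : 'rV[R]_n) r t :
  0 <= t <= 1 -> eball c a r (a + v) -> eball c a r (a + t *: v).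
Proof.
move=> /andP[t0 t1]; rewrite /eball /= ![a + _]addrC !addrK l2normZ.
rewrite ger0_norm //.
by apply: le_lteif_trans; rewrite ler_piMl // l2norm_ge0.
Qed.

(** * Spectral theorem for real symmetric matrices *)

Lemma char_poly_conjugate (K : comUnitRingType) n (P B : 'M[K]_n) :
  P \in unitmx -> char_poly (invmx P *m B *m P) = char_poly B.
Proof.
move=> Pu; rewrite /char_poly /char_poly_mx.
set Q := map_mx polyC P; set Q' := map_mx polyC (invmx P).
have Q'Q : Q' *m Q = 1%:M by rewrite -map_mxM mulVmx // map_mx1.
have -> : 'X%:M - map_mx polyC (invmx P *m B *m P) =
    Q' *m ('X%:M - map_mx polyC B) *m Q.
  by rewrite !map_mxM mulmxBr mulmxBl mul_mx_scalar -scalemxAl Q'Q scalemx1.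
by rewrite !det_mulmx mulrAC -det_mulmx Q'Q det1 mul1r.
Qed.

Local Notation cplx := (real_complex _).

(** In an orthonormal basis of eigenvectors, the weights [w i] are the squared
    moduli of the coordinates of [v]. Stating the result with weights keeps the
    complex unitary matrix out of sight: the basis found here is not real, but
    all that matters is that its eigenvalues and the weights are. *)
Lemma symmetric_spectral (R : realType) n (A : 'M[R]_n) :
  A^T = A -> exists D : 'I_n -> R,
  char_poly A = \prod_(i < n) ('X - (D i)%:P) /\
  forall v : 'rV[R]_n, exists w : 'I_n -> R,
    [/\ forall i, 0 <= w i, dot v v = \sum_i w i &
        dot (v *m A) v = \sum_i D i * w i].
Proof.
move=> symA; pose Ac : 'M[R[i]]_n := map_mx cplx A.
have cplx_real (x : R) : cplx x \is Num.real.
  by apply/complex_realP; exists x.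
have cplx_conj m (B : 'M[R]_(m, n)) :
    map_mx Num.conj (map_mx cplx B) = map_mx cplx B.
  by apply/matrixP => i j; rewrite !mxE conj_Creal.
have hermAc : Ac \is hermsymmx.
  apply: realsym_hermsym.
    apply/is_hermitianmxP; rewrite expr0 scale1r.
    by rewrite map_mx_id // map_trmx symA.
  by apply/mxOverP => i j; rewrite mxE.
have AE := orthomx_spectralP (hermitian_normalmx hermAc).
have rD := hermitian_spectral_diag_real hermAc.
set P := spectralmx Ac in AE; set Dc := spectral_diag Ac in AE rD.
have PU : P \is unitarymx by exact: spectral_unitarymx.
have Pu : P \in unitmx by exact: spectral_unit.
pose D i := complex.Re (Dc 0 i).
have DE i : Dc 0 i = cplx (D i).
  by rewrite /D -[LHS]RRe_real //; move/mxOverP : rD; exact.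
exists D; split.
  apply: (@map_poly_inj _ _ cplx); rewrite map_char_poly /= -/Ac AE.
  rewrite char_poly_conjugate //.
  rewrite char_poly_trig ?diag_mx_is_trig// rmorph_prod; apply: eq_bigr => i _.
  by rewrite mxE eqxx mulr1n DE rmorphB /= map_polyX map_polyC.
move=> v; pose u := map_mx cplx v *m invmx P.
pose w i := complex.Re (u 0 i * (u 0 i)^*).
have wE i : cplx (w i) = u 0 i * (u 0 i)^*.
  by rewrite /w RRe_real // ger0_real // mul_conjC_ge0.
have uE : (map_mx Num.conj u)^T = P *m (map_mx cplx v)^T.
  rewrite /u map_mxM cplx_conj trmx_mul invmx_unitary //.
  by rewrite -map_mx_comp (map_mx_id (@conjCK _)) trmxK.
have dot_cplx (x y : 'rV[R]_n) :
    cplx (dot x y) = (map_mx cplx x *m (map_mx cplx y)^T) 0 0.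
  by rewrite /dot map_trmx -map_mxM [in RHS]mxE.
exists w; split=> [i||].
- by rewrite -(@lecR R) wE mul_conjC_ge0.
- apply: (@complexI R); rewrite dot_cplx rmorph_sum /=.
  transitivity ((u *m (map_mx Num.conj u)^T) 0 0).
    by rewrite uE mulmxA mulmxKV.
  by rewrite mxE; apply: eq_bigr => i _; rewrite wE !mxE.
- apply: (@complexI R); rewrite dot_cplx rmorph_sum /=.
  transitivity ((u *m diag_mx Dc *m (map_mx Num.conj u)^T) 0 0).
    by rewrite uE map_mxM -/Ac AE !mulmxA.
  rewrite mxE; apply: eq_bigr => i _.
  by rewrite rmorphM /= wE -DE mul_mx_diag !mxE mulrAC mulrC mulrA.
Qed.

Lemma eigenvalues_correct (R : realType) n (A : 'M[R]_n) : A^T = A ->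
  sorted >=%R (eigenvalues A) /\
  char_poly A = \prod_(z <- eigenvalues A) ('X - z%:P).
Proof.
move=> symA; have [D [AD _]] := symmetric_spectral symA.
apply: (@xgetPex _ [::] [set s | sorted >=%R s /\
  char_poly A = \prod_(z <- s) ('X - z%:P)]).
exists (sort >=%R (codom D)); split; first exact/sort_sorted/ge_total.
rewrite AD (perm_big (codom D)) ?perm_sort //.
by rewrite /codom big_image.
Qed.

Lemma size_eigenvalues (R : realType) n (A : 'M[R]_n) :
  A^T = A -> size (eigenvalues A) = n.
Proof.
move=> /eigenvalues_correct[_ AE].
by have := size_char_poly A; rewrite AE size_prod_XsubC => -[].
Qed.

Lemma mem_eigenvalues (R : realType) n (A : 'M[R]_n) z :
  A^T = A -> (z \in eigenvalues A) = root (char_poly A) z.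
Proof. by move=> /eigenvalues_correct[_ ->]; rewrite root_prod_XsubC. Qed.

Lemma eigenvalue_lambda (R : realType) n (A : 'M[R]_n) k :
  A^T = A -> (0 < k <= n)%N -> eigenvalue A (lambda k A).
Proof.
move=> symA; case: k => // k kn.
by rewrite eigenvalue_root_char -mem_eigenvalues // mem_nth // size_eigenvalues.
Qed.

Lemma lambda_bounds (R : realType) n (A : 'M[R]_n) z :
  A^T = A -> z \in eigenvalues A -> lambda n A <= z <= lambda 1 A.
Proof.
move=> symA; have [sA _] := eigenvalues_correct symA.
case/(nthP 0) => i; rewrite (size_eigenvalues symA) => i_n <-.
have ge_nth j k : (j <= k < n)%N ->
    (eigenvalues A)`_k <= (eigenvalues A)`_j.
  move=> /andP[jk kn].
  have := sorted_leq_nth (@ge_trans _ R) (@ge_refl _ R) 0 sA.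
  by apply; rewrite ?inE ?(size_eigenvalues symA) // (leq_ltn_trans jk).
have n_gt0 : (0 < n)%N by exact: leq_ltn_trans i_n.
by rewrite /lambda !ge_nth // ?prednK // ?leqnn ?andbT // -ltnS prednK.
Qed.

Lemma Rayleigh_bounds (R : realType) n (A : 'M[R]_n) (v : 'rV[R]_n) :
  A^T = A -> lambda n A * dot v v <= dot (v *m A) v <= lambda 1 A * dot v v.
Proof.
move=> symA; have [D [AD Aw]] := symmetric_spectral symA.
have [w [w0 -> ->]] := Aw v.
have Dbounds i : lambda n A <= D i <= lambda 1 A.
  apply: lambda_bounds => //; rewrite mem_eigenvalues // AD.
  by rewrite rootE (bigD1 i) //= hornerM hornerXsubC subrr mul0r.
rewrite !mulr_sumr; apply/andP; split; apply: ler_sum => i _;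
  by apply: ler_wpM2r => //; have /andP[] := Dbounds i.
Qed.

Lemma lambda_dim0 (R : realType) n k (A : 'M[R]_n) : A^T = A -> n = 0%N ->
  lambda k A = 0.
Proof.
by move=> symA n0; rewrite /lambda nth_default // size_eigenvalues // n0.
Qed.

(** * Positive definite and Gram matrices *)

Lemma dot_gram (R : realType) m n (B : 'M[R]_(m, n)) (v : 'rV[R]_n) :
  dot (v *m (B^T *m B)) v = dot (v *m B^T) (v *m B^T).
Proof. by rewrite /dot trmx_mul trmxK !mulmxA. Qed.

Lemma gram_sym (R : realType) m n (B : 'M[R]_(m, n)) :
  (B^T *m B)^T = B^T *m B.
Proof. by rewrite trmx_mul trmxK. Qed.

(** The eigenvalue of [S^T S] at an eigenvector [v] is [|S v|^2 / |v|^2], and a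
    positive definite [S] does not annihilate [v]. *)
Lemma lambda_gram_gt0 (R : realType) n k (S : 'M[R]_n) : S^T = S ->
  posdefmx S -> (0 < k <= n)%N -> 0 < lambda k (S^T *m S).
Proof.
move=> symS Spos kn.
have /eigenvalueP[v vE v0] := eigenvalue_lambda (gram_sym S) kn.
have := dot_gram S v; rewrite vE dotZl symS => lE.
rewrite -(pmulr_lgt0 _ (dot_gt0 v0)) lE dot_gt0 //.
by apply: contraTneq (Spos v v0) => ->; rewrite mul0mx mxE ltxx.
Qed.

(** An eigenvector [u] of [S] for its smallest eigenvalue [mu] is one of [S^T S]
    for [mu ^+ 2], so [a <= mu ^+ 2]. Positivity of [mu] selects the root
    [sqrt a <= mu]: this is where positive definiteness of [S] enters. *)
Lemma posdef_lower_bound (R : realType) n (S : 'M[R]_n) a : S^T = S ->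
  posdefmx S -> a <= lambda n (S^T *m S) ->
  forall v, Num.sqrt a * dot v v <= dot (v *m S) v.
Proof.
move=> symS Spos al v.
have [n0|n_gt0] := posnP n.
  rewrite !dotE !big1 ?mulr0 // => j;
    by have := ltn_ord j; rewrite [X in (_ < X)%N]n0.
have kn : (0 < n <= n)%N by rewrite n_gt0 leqnn.
have /eigenvalueP[u uE u0] := eigenvalue_lambda symS kn.
have mu_gt0 : 0 < lambda n S.
  have := Spos u u0; rewrite -/(dot (u *m S) u) uE dotZl.
  by rewrite pmulr_lgt0 // dot_gt0.
have a_le : a <= lambda n S ^+ 2.
  have /andP[+ _] := Rayleigh_bounds u (gram_sym S).
  rewrite dot_gram symS uE dotZl dotC dotZl mulrA -expr2.
  by rewrite ler_pM2r ?dot_gt0 //; apply: le_trans; rewrite symS in al.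
have /andP[+ _] := Rayleigh_bounds v symS; apply: le_trans.
rewrite ler_wpM2r ?dot_ge0 //.
by rewrite -[leRHS](ger0_norm (ltW mu_gt0)) -sqrtr_sqr ler_wsqrtr.
Qed.

(** * Mean value inequality *)

(** Pairing with a fixed [w] gives scalar functions along the line, to which the
    one-variable mean value theorem applies. *)
Lemma is_derive_dot_path (R : realType) m n (g : 'rV[R]_m -> 'rV[R]_n)
    (a v : 'rV[R]_m) (w : 'rV[R]_n) (t : R) :
  derivable g (a + t *: v) v ->
  is_derive t 1 (fun s : R => dot (g (a + s *: v)) w)
    (dot ('D_v g (a + t *: v)) w).
Proof.
move=> dg.
(* Along the line, both derivatives are limits of the same quotients. *)
have quotE :
    (fun h : R => h^-1 *: (g (a + (h *: 1 + t) *: v) - g (a + t *: v))) =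
    (fun h : R => h^-1 *: (g (h *: v + (a + t *: v)) - g (a + t *: v))).
  apply/funext => h; congr (_ *: (g _ - _)).
  by rewrite scalerDl /GRing.scale /= mulr1 addrCA.
have derivable_gp : derivable (fun s : R => g (a + s *: v)) t 1.
  by rewrite /derivable quotE.
have Dgp : 'D_1 (fun s : R => g (a + s *: v)) t = 'D_v g (a + t *: v).
  by rewrite /derive quotE.
have gp_j j : is_derive t 1 (fun s : R => g (a + s *: v) 0 j)
    ('D_v g (a + t *: v) 0 j).
  rewrite -Dgp derive_mx ?mxE //.
  by apply: DeriveDef => //; have /derivable_mxP := derivable_gp; exact.
have -> : (fun s : R => dot (g (a + s *: v)) w) =
    \sum_j (w 0 j \*: (fun s : R => g (a + s *: v) 0 j)).
  apply/funext => s; rewrite dotE fct_sumE; apply: eq_bigr => j _ /=.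
  by rewrite mulrC.
have dsum := is_derive_sum (fun j => is_deriveZ (w 0 j) (gp_j j)).
apply: is_derive_eq dsum _.
by rewrite dotE; apply: eq_bigr => j _; rewrite mulrC.
Qed.

(** The one-variable theorem is applied to [t |-> <g (a + t v), w>] for the
    increment [w = g (a + v) - g a] itself: at some [t] it gives
    [<w, w> = <y, w>] with [y] the directional derivative, and
    [|y - w|^2 >= 0] then reads [|w|^2 <= |y|^2]. *)
Lemma mean_value_l2norm (R : realType) m n (g : 'rV[R]_m -> 'rV[R]_n)
    (a v : 'rV[R]_m) : (forall x, derivable g x v) ->
  exists2 t : R, 0 <= t <= 1 &
    l2norm (g (a + v) - g a) <= l2norm ('D_v g (a + t *: v)).
Proof.
move=> dg; set w := g (a + v) - g a.
have dphi (t : R) := is_derive_dot_path w (dg (a + t *: v)).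
have [|t t01] := MVT_segment (@ler01 R) (fun t _ => dphi t).
  apply: derivable_within_continuous => t _; exact: ex_derive.
rewrite scale1r scale0r addr0 subr0 mulr1 -dotBl -/w => wE.
exists t; first by move: t01; rewrite in_itv.
rewrite !l2normE ler_wsqrtr //.
have := dot_ge0 ('D_v g (a + t *: v) - w).
rewrite dot_sqrB -wE; lra.
Qed.

(** * Contraction and rate of convergence *)

(** For row vectors, [v *m J^T] is the product of [J] with the column [v]. The
    quadratic form of [J] only sees [S], whence the lower bound on the inner
    product of [v] and [J v]; the bound [b] controls the square of [J v]. *)
Lemma contraction_step (R : realType) n (J : 'M[R]_n) (a b : R) :
  let S := 2^-1 *: (J + J^T) in
  0 < a -> a < b -> posdefmx S -> a <= lambda n (S^T *m S) ->
  lambda 1 (J^T *m J) <= b ->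
  forall v : 'rV[R]_n,
    l2norm (v - (Num.sqrt a / b) *: (v *m J^T)) <=
    Num.sqrt (1 - a / b) * l2norm v.
Proof.
move=> S a_gt0 ab Spos aS Jb v.
have b_gt0 : 0 < b by exact: lt_trans ab.
have symS : S^T = S by rewrite /S linearZ linearD /= trmxK addrC.
have low := posdef_lower_bound symS Spos aS v.
(* [J] and [J^T] have the same quadratic form. *)
have SJ : dot (v *m S) v = dot v (v *m J^T).
  rewrite /S -scalemxAr dotZl mulmxDr /dot mulmxDl mxE.
  have -> : (v *m J *m v^T) 0 0 = (v *m (v *m J^T)^T) 0 0.
    by rewrite trmx_mul trmxK mulmxA.
  rewrite -!/(dot _ _) (dotC (v *m J^T)). lra.
have /andP[_ up] := Rayleigh_bounds v (gram_sym J).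
rewrite dot_gram in up.
have {}up : dot (v *m J^T) (v *m J^T) <= b * dot v v.
  by apply: le_trans up _; rewrite ler_wpM2r // dot_ge0.
rewrite SJ in low.
rewrite !l2normE -sqrtrM ?subr_ge0 ?ler_pdivrMr ?mul1r ?(ltW ab) //.
rewrite ler_wsqrtr // dot_sqrB dotZl ![dot v (_ *: _)]dotC.
rewrite ![dot _ (_ *: _)]dotC !dotZl.
rewrite (dotC _ v).
set s := Num.sqrt a in low *.
have aE : a = s ^+ 2 by rewrite sqr_sqrtr // ltW.
have s_ge0 : 0 <= s by exact: sqrtr_ge0.
have h1 := ler_wpM2l (divr_ge0 s_ge0 (ltW b_gt0)) low.
have h2 := ler_wpM2l (sqr_ge0 (s / b)) up.
(* The bounds give the factor [1 - 2 g s + g ^+ 2 b] for a step size [g]; it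
   is minimal at [g = s / b], with minimum [1 - s ^+ 2 / b]. *)
apply: (@le_trans _ _ (dot v v - 2 * (s / b * (s * dot v v)) +
                       (s / b) ^+ 2 * (b * dot v v))).
  move: h1 h2; rewrite expr2; lra.
rewrite aE le_eqVlt; apply/orP; left; apply/eqP; field; exact: lt0r_neq0.
Qed.

(** From [1 - kappa <= expR (- kappa)], that is
    [sqrt (1 - kappa) <= expR (- (kappa / 2))]. *)
Lemma geometric_rate (R : realType) (kappa r eps : R) (k : nat) :
  0 < kappa -> kappa <= 1 -> 0 < r -> 0 < eps ->
  2 / kappa * ln (r / eps) <= k%:R ->
  Num.sqrt (1 - kappa) ^+ k * r <= eps.
Proof.
move=> kappa_gt0 kappa_le1 r_gt0 eps_gt0 kP.
have step : Num.sqrt (1 - kappa) <= expR (- (kappa / 2)).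
  rewrite -[leRHS]ger0_norm ?expR_ge0 // -sqrtr_sqr ler_wsqrtr // -expRM_natl.
  have -> : 2%:R * - (kappa / 2) = - kappa by field.
  exact: expR_ge1Dx.
have -> : r = eps * expR (ln (r / eps)).
  by rewrite lnK ?posrE ?divr_gt0 // mulrC divfK // lt0r_neq0.
rewrite mulrCA ler_piMr ?(ltW eps_gt0) //.
apply: (@le_trans _ _ (expR (- (kappa / 2)) ^+ k * expR (ln (r / eps)))).
  by rewrite ler_wpM2r ?expR_ge0 // lerXn2r ?nnegrE ?sqrtr_ge0 ?expR_ge0.
rewrite -expRM_natl -expRD -[leRHS]expR0 ler_expR.
have := ler_wpM2l (ltW kappa_gt0) kP.
rewrite mulrA mulrCA divff ?mulr1; last exact: lt0r_neq0.
lra.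
Qed.

Lemma differentiable_rV (R : realType) m n (g : 'rV[R]_m -> 'rV[R]_n) x :
  (forall j, differentiable (fun y => g y 0 j) x) -> differentiable g x.
Proof.
move=> dg; have -> : g = \sum_j (fun y => g y 0 j *: delta_mx 0 j).
  by apply/funext => y; rewrite fct_sumE [LHS]row_sum_delta.
by apply: differentiable_sum => j; exact: differentiableZl.
Qed.

Lemma differentiable_omega (R : realType) (n : nat) (d : 'I_n -> nat)
    (f : 'I_n -> 'rV[R]_(\sum_(i < n) d i) -> R) (q : nat) :
  (2 <= q)%N -> (forall i, is_C q (f i)) ->
  forall x, differentiable (omega f) x.
Proof.
case: q => [//|[//|q]] _ fC x; apply: differentiable_rV => k.
have -> : (fun y => omega f y 0 k) =
    'D_(e_ R (tagnat.sig2 k)) (f (tagnat.sig1 k)).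
  by apply/funext => y; rewrite !mxE.
by have [_ /(_ (e_ R (tagnat.sig2 k)))[]] := fC (tagnat.sig1 k).
Qed.

Theorem theorem1 (R : realType) (n : nat) (d : 'I_n -> nat)
    (f : 'I_n -> 'rV[R]_(\sum_(i < n) d i) -> R) (q : nat) (L : R)
    (xs x0 : 'rV[R]_(\sum_(i < n) d i)) (c : bool) (r alpha beta eps : R)
    (hq : (2 <= q)%N)
    (hf : forall i : 'I_n, is_C q (f i))
    (hL : l2_lipschitz L (omega f))
    (hNash : differential_Nash f xs)
    (hstable : stable f xs)
    (hr : attraction_ball f c xs r)
    (halpha : is_minimum
       [set lambda (\sum_(i < n) d i) ((sym_jacobian f x)^T *m sym_jacobian f x)
         | x in eball c xs r] alpha)
    (hbeta : is_maximum
       [set lambda 1 ((game_jacobian f x)^T *m game_jacobian f x)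
         | x in eball c xs r] beta)
    (hx0 : eball c xs r x0)
    (hab : alpha < beta)
    (heps : 0 < eps) :
  forall k : nat,
    Num.ceil (2 * (beta / alpha) * ln (r / eps)) <= k%:Z ->
    eball c xs eps (gradient_play f (Num.sqrt alpha / beta) x0 k) /\
    (eps <= r -> eball c xs eps `<=` eball c xs r).
Proof.
have [r_gt0 _ Spos] := hr.
have [[xa xa_ball alphaE] alpha_lb] := halpha.
have [[xb xb_ball betaE] beta_ub] := hbeta.
have symS x : (sym_jacobian f x)^T = sym_jacobian f x.
  by rewrite /sym_jacobian linearZ linearD /= trmxK addrC.
(* Over the zero space [alpha] and [beta] would both be 0. *)
have N_gt0 : (0 < \sum_(i < n) d i)%N.
  rewrite lt0n; apply: contraTneq hab => N0.
  by rewrite -alphaE -betaE !lambda_dim0 ?gram_sym // ltxx.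
have alpha_gt0 : 0 < alpha.
  rewrite -alphaE; apply: lambda_gram_gt0 (symS xa) (Spos _ xa_ball) _.
  by rewrite N_gt0 leqnn.
have beta_gt0 : 0 < beta by exact: lt_trans hab.
have domega := differentiable_omega hq hf.
set gamma := Num.sqrt alpha / beta.
set rho := Num.sqrt (1 - alpha / beta).
have rho_gt0 : 0 < rho by rewrite sqrtr_gt0 subr_gt0 ltr_pdivrMr ?mul1r.
have rho_le1 : rho <= 1.
  by rewrite -sqrtr1 ler_wsqrtr // gerBl divr_ge0 // ltW.
pose T x := x - gamma *: omega f x.
have TE x v : is_derive x v T (v - gamma *: (v *m (game_jacobian f x)^T)).
  rewrite /game_jacobian trmxK -deriveEjacobian //.
  apply: is_deriveB; apply: is_deriveZ; apply: DeriveDef => //.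
  exact: diff_derivable.
(* The linear bound holds at every point of the segment from [xs] to [x]. *)
have contract x : eball c xs r x -> l2norm (T x - xs) <= rho * l2norm (x - xs).
  move=> x_ball; pose v := x - xs.
  have xE : x = xs + v by rewrite addrC subrK.
  have Txs : T xs = xs by rewrite /T hNash.1 scaler0 subr0.
  have dT y : derivable T y v by case: (TE y v).
  have [t t01] := mean_value_l2norm xs dT.
  rewrite -xE Txs derive_val => /le_trans; apply.
  have y_ball : eball c xs r (xs + t *: v).
    by apply: eball_segment; rewrite -?xE.
  apply: contraction_step => //; first exact: Spos.
  - by apply: alpha_lb; exists (xs + t *: v).
  - by apply: beta_ub; exists (xs + t *: v).
move=> k; rewrite ceil_le_int => kP; split; last first.
  by move=> eps_r x x_ball; apply: lteif_le_trans x_ball _.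
have [_ xk] : eball c xs r (gradient_play f gamma x0 k) /\
    l2norm (gradient_play f gamma x0 k - xs) <= rho ^+ k * l2norm (x0 - xs).
  elim: k {kP} => [|k [xk_ball xk]]; first by rewrite expr0 mul1r.
  have step := contract _ xk_ball; split.
    apply: le_lteif_trans xk_ball; apply: le_trans step _.
    by rewrite ler_piMl ?l2norm_ge0.
  apply: le_trans step _.
  by rewrite exprS -mulrA ler_wpM2l // ltW.
have rate : rho ^+ k * r <= eps.
  apply: geometric_rate; rewrite ?divr_gt0 ?ler_pdivrMr ?mul1r ?(ltW hab) //.
  by move: kP; rewrite invf_div -mulrA.
(* For the open ball, strictness of [l2norm (x0 - xs) < r] survives because
   [rho] is positive, that is because [alpha < beta]. *)
apply: lteif_le_trans rate; apply: le_lteif_trans xk _.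
by rewrite ![rho ^+ k * _]mulrC lteif_pM2r ?exprn_gt0.
Qed.
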